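(* Let $p \geq 1$. Let $G$ be a graph on $n$ vertices, let $e$ be an edge of $G$, and let $H = G - e$. Let $\lambda_1 \geq \cdots \geq \lambda_n$ and $\theta_1 \geq \cdots \geq \theta_n$ denote the eigenvalues of the adjacency matrices $A(G)$ and $A(H)$, respectively. If $H$ has at least two positive eigenvalues and at least two negative eigenvalues, then \[ \mathcal{E}_p^+(G) \geq \mathcal{E}_p^+(H) + \max\{\theta_2 - 1, 0\}^p - \theta_2^p, \] and \[ \mathcal{E}_p^-(G) \geq \mathcal{E}_p^-(H) + \max\{-\theta_{n}-1, 0\}^p - |\theta_n|^p. \]
   Context: All graphs are finite, simple, undirected and unweighted; the eigenvalues of a graph are those of its (real symmetric) adjacency matrix. For a graph $G$ with adjacency eigenvalues $\lambda_i(G)$ and a real $p>0$, the positive $p$-energy is $\mathcal{E}_p^+(G) = \sum_{\lambda_i(G) > 0} \lambda_i(G)^p$ and the negative $p$-energy is $\mathcal{E}_p^-(G) = \sum_{\lambda_i(G) < 0} |\lambda_i(G)|^p$ (eigenvalues counted with multiplicity). $G - e$ denotes the graph obtained from $G$ by deleting the edge $e$. *)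

(* Defs.v *)
From HB Require Import structures.
From mathcomp Require Import all_boot all_order all_algebra.
From mathcomp Require Import spectral polyrcf complex.
From mathcomp Require Import reals exp.

Set Implicit Arguments.
Unset Strict Implicit.
Unset Printing Implicit Defensive.

Import Order.TTheory GRing.Theory Num.Theory.

Local Open Scope ring_scope.

Record sgraph (V : finType) := SGraph {
  adj :> rel V;
  adj_sym : symmetric adj;
  adj_irr : irreflexive adj }.

Definition edges (V : finType) (G : sgraph V) : {set {set V}} :=
  [set [set z.1; z.2] | z in [set z : V * V | adj G z.1 z.2]].

Section DeleteEdge.
Variables (V : finType) (G : sgraph V) (e : {set V}).

Definition del_adj : rel V := fun x y => adj G x y && ([set x; y] != e).

Lemma del_adj_sym : symmetric del_adj.
Proof. by move=> x y; rewrite /del_adj adj_sym setUC. Qed.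

Lemma del_adj_irr : irreflexive del_adj.
Proof. by move=> x; rewrite /del_adj adj_irr. Qed.

Definition del_edge : sgraph V := SGraph del_adj_sym del_adj_irr.

Lemma edges_del_edge : edges del_edge = edges G :\ e.
Proof.
apply/setP=> f; rewrite !inE; apply/imsetP/idP.
  move=> [[x y]]; rewrite !inE /= => /andP[xy xyNe] ->.
  by rewrite xyNe; apply/imsetP; exists (x, y); rewrite ?inE.
case/andP=> fNe /imsetP[[x y]]; rewrite !inE /= => xy fE.
by exists (x, y) => //; rewrite inE /= /del_adj xy -fE.
Qed.

End DeleteEdge.

Definition adjmx (R : pzRingType) (V : finType) (G : sgraph V) : 'M[R]_#|V| :=
  \matrix_(i, j) (adj G (enum_val i) (enum_val j))%:R.

(* [rootsR q] lists the distinct real roots of q in increasing order, so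
   [eigenvalues A] lists the real eigenvalues of A in nonincreasing order,
   each repeated according to its algebraic multiplicity; when A is symmetric
   these are all n eigenvalues (see [char_poly_eigenvalues]). *)
Definition eigenvalues (R : rcfType) (n : nat) (A : 'M[R]_n) : seq R :=
  rev (flatten [seq nseq (mup x (char_poly A)) x | x <- rootsR (char_poly A)]).

Section EigenvaluesTheory.
Variables (R : rcfType) (n : nat).
Implicit Type A : 'M[R]_n.

Lemma char_poly_neq0 A : char_poly A != 0.
Proof. exact/monic_neq0/char_poly_monic. Qed.

Lemma mem_rootsR A x : (x \in rootsR (char_poly A)) = root (char_poly A) x.
Proof.
by rewrite -(roots_on_rootsR (char_poly_neq0 A)) in_itv.
Qed.

Lemma count_eigenvalues A x :
  count_mem x (eigenvalues A) = mup x (char_poly A).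
Proof.
rewrite /eigenvalues count_rev count_flatten -map_comp.
rewrite (eq_map (g := fun y => ((y == x) * mup y (char_poly A))%N)); last first.
  by move=> y /=; rewrite count_nseq.
rewrite sumnE big_map.
have [xr|xNr] := boolP (root (char_poly A) x); last first.
  rewrite mupNroot // big1 // => y _.
  by case: eqVneq => // ->; rewrite mupNroot.
rewrite (bigD1_seq x) ?mem_rootsR ?uniq_roots //= eqxx mul1n big1 ?addn0 //.
by move=> y /negPf ->.
Qed.

Lemma sorted_eigenvalues A : sorted >=%R (eigenvalues A).
Proof.
rewrite /eigenvalues rev_sorted.
have : sorted <%R (rootsR (char_poly A)) by exact: sorted_roots.
rewrite !sorted_pairwise; [|exact: le_trans|exact: lt_trans].
elim: (rootsR _) => //= x s IH /andP[/allP xs /IH ps].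
rewrite pairwise_cat ps andbT; apply/andP; split.
  apply/allrelP=> y z /nseqP[-> _] /flattenP[t /mapP[w ws ->] /nseqP[-> _]].
  exact/ltW/xs.
by elim: (mup _ _) => //= k ->; rewrite andbT; apply/allP=> y /nseqP[->].
Qed.

Lemma sym_char_poly_split A : A^T = A ->
  exists s : seq R, char_poly A = \prod_(x <- s) ('X - x%:P).
Proof.
move=> symA; pose B := map_mx (@real_complex R) A.
have Bsym : B \is symmetricmx.
  apply/is_hermitianmxP; rewrite expr0 scale1r /B.
  by apply/matrixP=> i j; rewrite !mxE -[in LHS]symA mxE.
have Breal : B \is a realmx.
  by apply/mxOverP=> i j; rewrite mxE; apply/complex_realP; exists (A i j).
have Bherm := realsym_hermsym Bsym Breal.
have /mxOverP dreal := hermitian_spectral_diag_real Bherm.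
have /orthomx_spectralP BE := hermitian_normalmx Bherm.
pose d := spectral_diag B; pose P := spectralmx B.
have Pu : P \in unitmx := spectral_unit B.
have cB : char_poly B = char_poly (diag_mx d).
  rewrite [in LHS]BE /char_poly /char_poly_mx -/P -/d.
  have PP : map_mx polyC (invmx P) *m map_mx polyC P = 1%:M.
    by rewrite -map_mxM mulVmx // map_mx1.
  have -> : 'X%:M - map_mx polyC (invmx P *m diag_mx d *m P) =
     map_mx polyC (invmx P) *m ('X%:M - map_mx polyC (diag_mx d))
       *m map_mx polyC P.
    rewrite mulmxBr mulmxBl -!map_mxM; congr (_ - _).
    by rewrite scalar_mxC -mulmxA PP mulmx1.
  by rewrite !det_mulmx mulrAC -det_mulmx PP det1 mul1r.
have cD : char_poly (diag_mx d) = \prod_(i < n) ('X - (d 0 i)%:P).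
  rewrite char_poly_trig ?diag_mx_is_trig //.
  by apply: eq_bigr => i _; rewrite mxE eqxx.
exists [seq complex.Re (d 0 i) | i <- enum 'I_n].
apply: (@map_poly_inj _ _ (@real_complex R)).
rewrite map_char_poly -/B cB cD rmorph_prod big_map big_enum /=.
apply: eq_bigr => i _; rewrite rmorphB /= map_polyX map_polyC /=.
by rewrite RRe_real // dreal.
Qed.

Lemma char_poly_eigenvalues A : A^T = A ->
  char_poly A = \prod_(x <- eigenvalues A) ('X - x%:P).
Proof.
case/sym_char_poly_split=> s sE; rewrite [LHS]sE; apply: perm_big.
apply/allP=> x _; apply/eqP.
by rewrite [RHS]count_eigenvalues sE mu_prod_XsubC.
Qed.

Lemma size_eigenvalues A : A^T = A -> size (eigenvalues A) = n.
Proof.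
move=> /char_poly_eigenvalues /(congr1 (size \o polyseq)) /=.
by rewrite size_char_poly size_prod_XsubC => -[].
Qed.

End EigenvaluesTheory.

Lemma adjmx_sym (R : pzRingType) (V : finType) (G : sgraph V) :
  (adjmx R G)^T = adjmx R G.
Proof. by apply/matrixP=> i j; rewrite !mxE adj_sym. Qed.

(* The index i is 1-based: [eigval R G 1] is the largest eigenvalue of G. *)
Definition eigval (R : realType) (V : finType) (G : sgraph V) (i : nat) : R :=
  (eigenvalues (adjmx R G))`_i.-1.

Definition pos_energy (R : realType) (p : R) (V : finType) (G : sgraph V) : R :=
  \sum_(x <- eigenvalues (adjmx R G) | 0 < x) x `^ p.

Definition neg_energy (R : realType) (p : R) (V : finType) (G : sgraph V) : R :=
  \sum_(x <- eigenvalues (adjmx R G) | x < 0) `|x| `^ p.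

(* Main.v *)
(* With w, v the difference and the sum of the two basis vectors at the ends
   of e, A(G) = A(H) - w w^T / 2 + v v^T / 2. The eigenvalues mu_i of
   M = A(H) - w w^T / 2 interlace downwards those of H, theta_(i+1) <= mu_i <=
   theta_i, they lie below those of G, and taking traces the total descent
   \sum_i (theta_i - mu_i) is 1. For the convex nondecreasing function
   f(x) = max(x, 0)^p, such a descent costs \sum_i f(theta_i) at most what it
   costs when it is made entirely at the largest eigenvalue. For the positive
   energy the index 1 is left out, as lambda_1 >= theta_1 by Perron-Frobenius;
   for the negative energy the argument is applied to -A(G) and -A(H), with v
   and w exchanged. *)
Require Import Defs.
From mathcomp Require Import all_boot all_order all_algebra.
From mathcomp Require Import spectral complex interval interval_inference.
From mathcomp Require Import reals exp convex hoelder.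
From mathcomp Require Import ring lra.
Set Implicit Arguments.
Unset Strict Implicit.
Unset Printing Implicit Defensive.
Import Order.TTheory GRing.Theory Num.Theory.
Local Open Scope ring_scope.

(** * Hermitian forms over row vectors and eigenvalue counting *)

Section HermitianForms.
Local Open Scope sesquilinear_scope.
Context {C : numClosedFieldType}.

Definition hform n (M : 'M[C]_n) (x : 'rV[C]_n) : C := (x *m M *m x^t*) 0 0.

Lemma hformD n (M N : 'M[C]_n) x : hform (M + N) x = hform M x + hform N x.
Proof. by rewrite /hform mulmxDr mulmxDl mxE. Qed.

Lemma hform_diag n (d x : 'rV[C]_n) :
  hform (diag_mx d) x = \sum_i d 0 i * `|x 0 i| ^+ 2.
Proof.
rewrite /hform mxE; apply: eq_bigr => i _.
by rewrite mul_mx_diag !mxE normCK mulrAC mulrA [d 0 i * _]mulrC mulrAC.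
Qed.

Lemma hform1 n (x : 'rV[C]_n) : hform 1%:M x = \sum_i `|x 0 i| ^+ 2.
Proof.
by rewrite -diag_const_mx hform_diag; apply: eq_bigr => i _; rewrite mxE mul1r.
Qed.

Lemma hform_conj n (P M : 'M[C]_n) x :
  hform (P^t* *m M *m P) x = hform M (x *m P^t*).
Proof. by rewrite /hform trmx_mul map_mxM /= trmxCK !mulmxA. Qed.

Lemma hform1_unitary n (P : 'M[C]_n) x :
  P \is unitarymx -> hform 1%:M (x *m P^t*) = hform 1%:M x.
Proof.
move=> Pu; rewrite -hform_conj mulmx1 -[P in _ *m P]trmxCK.
by have /unitarymxP -> : P^t* \is unitarymx by rewrite trmxC_unitary.
Qed.

Lemma row_neq0_ker m n (M : 'M[C]_(m, n)) : (n < m)%N ->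
  exists2 y : 'rV[C]_m, y != 0 & y *m M = 0.
Proof.
move=> nm; have : kermx M != 0.
  by rewrite kermx_eq0 /row_free neq_ltn (leq_ltn_trans (rank_leq_col M)).
by case/rowV0Pn=> y /sub_kermxP yM y0; exists y.
Qed.

(* A nonzero vector in the span of the eigenvectors of the first form with
   eigenvalue >= t, orthogonal to those of the second one, and killed by w,
   exists by a dimension count as soon as the inequality fails. *)
Lemma card_eigen_ge_le n r (P Q : 'M[C]_n) (a b : 'rV[C]_n)
    (w : 'M[C]_(n, r)) (t : C) :
  P \is unitarymx -> Q \is unitarymx ->
  t \is Num.real -> (forall i, b 0 i \is Num.real) ->
  (forall x, x *m w = 0 ->
     hform (P^t* *m diag_mx a *m P) x <= hform (Q^t* *m diag_mx b *m Q) x) ->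
  (#|[set i | (t <= a 0 i)%R]| <= #|[set i | (t <= b 0 i)%R]| + r)%N.
Proof.
move=> Pu Qu tr br leab; rewrite leqNgt; apply/negP => ltK.
set K := [set i | t <= a 0 i] in ltK; set L := [set i | t <= b 0 i] in ltK.
(* The unknown [y] lists coordinates in the basis of rows of [P]. Killing [M1] makes [y] supported
   on [K], and killing [M2] makes [y *m P] orthogonal to the rows of [Q] indexed by [L]. With the
   [r] columns of [P *m w] this gives fewer than [n] conditions by [ltK]. *)
pose M1 : 'M[C]_(n, #|~: K|) := colsub (fun j => enum_val j) 1%:M.
pose M2 : 'M[C]_(n, #|L|) := colsub (fun j => enum_val j) (P *m Q^t*).
have [] := row_neq0_ker (row_mx M1 (row_mx M2 (P *m w))).
  have := cardsC K; rewrite card_ord => nE.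
  by rewrite -[X in (_ < X)%N]nE addnC ltn_add2r.
move=> y y0; rewrite !mul_mx_row -[0]row_mx0.
move=> /eq_row_mx[yM1]; rewrite -[0]row_mx0 => /eq_row_mx[yM2 yw].
have yK i : i \notin K -> y 0 i = 0.
  move=> iK; have iK' : i \in ~: K by rewrite inE.
  have /rowP/(_ (enum_rank_in iK' i)) := yM1.
  by rewrite mulmx_colsub mulmx1 !mxE enum_rankK_in.
have zL i : i \in L -> (y *m P *m Q^t*) 0 i = 0.
  move=> iL; have /rowP/(_ (enum_rank_in iL i)) := yM2.
  by rewrite mulmx_colsub mulmxA mxE enum_rankK_in // => ->; rewrite mxE.
have yPP : y *m P *m P^t* = y by rewrite -mulmxA (unitarymxP Pu) mulmx1.
have {leab} := leab (y *m P) (etrans (esym (mulmxA _ _ _)) yw).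
rewrite !hform_conj yPP !hform_diag; set z := _ *m Q^t*.
have nyz : \sum_i `|y 0 i| ^+ 2 = \sum_i `|z 0 i| ^+ 2.
  by rewrite -!hform1 -[y in LHS]yPP (hform1_unitary _ Pu) (hform1_unitary _ Qu).
have le1 : t * \sum_i `|y 0 i| ^+ 2 <= \sum_i a 0 i * `|y 0 i| ^+ 2.
  rewrite mulr_sumr; apply: ler_sum => i _.
  have [|/yK ->] := boolP (i \in K); last by rewrite normr0 expr0n !mulr0.
  by rewrite inE => ?; rewrite ler_wpM2r // exprn_ge0.
(* The equality case is recorded because [le1], the assumed comparison and equality of norms squeeze
   the two sums together. Equality in every term then forces [z = 0], hence [y = 0]. *)
have term i : b 0 i * `|z 0 i| ^+ 2 <= t * `|z 0 i| ^+ 2 ?= iff (z 0 i == 0).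
  have [|] := boolP (i \in L).
    by move=> /zL ->; rewrite eqxx normr0 expr0n !mulr0; apply/leif_refl.
  rewrite inE -real_ltNge // => bt; apply/leifP.
  case: eqVneq => [->|zi]; first by rewrite normr0 expr0n !mulr0.
  by rewrite ltr_pM2r // exprn_gt0 // normr_gt0.
have := leif_sum (P := predT) (fun i _ => term i); rewrite -mulr_sumr -nyz => le2.
move=> le3; have := le_trans le1 le3.
rewrite (ge_leif le2) => /forall_inP zi0; case/eqP: y0.
have z0 : \sum_i `|z 0 i| ^+ 2 = 0.
  by apply: big1 => i _; rewrite (eqP (zi0 i isT)) normr0 expr0n.
apply/rowP => i; rewrite mxE; apply/eqP; rewrite -normr_eq0 -sqrf_eq0.
move/eqP: z0; rewrite -nyz psumr_eq0 => [/allP/(_ i)|j _].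
  by rewrite mem_index_enum => /(_ isT).
exact: exprn_ge0.
Qed.

End HermitianForms.

(** * From counts above a threshold to entries of nonincreasing sequences *)

Section NonincreasingSeq.
Context {R : realDomainType}.
Implicit Types (s t : seq R) (P : pred R).

(** In a nonincreasing sequence the entries satisfying an upward closed [P] form a prefix, whose
    length is the count. *)
Lemma sorted_nth_count s P i :
  sorted >=%R s -> {homo P : x y / x <= y >-> x ==> y} ->
  (i < count P s)%N -> P s`_i.
Proof.
move=> + Pup; rewrite sorted_pairwise; last first.
  by move=> y x z /= /[swap]; apply: le_trans.
elim: s i => [|x s IH] [|i] //= /andP[/allP xs ps] lti.
  case Px : (P x) lti => //=; rewrite add0n -has_count => /hasP[y ys Py].
  by have /= /implyP := Pup _ _ (xs _ ys); rewrite Px => /(_ Py).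
by apply: IH => //; case: (P x) lti => //=; rewrite add0n; apply: ltnW.
Qed.

(** Converse of the preceding lemma. The bound on [i] excludes the default value 0 of an
    out-of-range entry, which might satisfy [P]. *)
Lemma sorted_count_nth s P i :
  sorted >=%R s -> {homo P : x y / x <= y >-> x ==> y} ->
  (i < size s)%N -> P s`_i -> (i < count P s)%N.
Proof.
move=> + Pup; rewrite sorted_pairwise; last first.
  by move=> y x z /= /[swap]; apply: le_trans.
elim: s i => [|x s IH] [|i] //= /andP[/allP xs ps] lti.
  by move=> ->.
move=> Psi; have /implyP/(_ Psi) -> := Pup _ _ (xs _ (mem_nth 0 lti)).
by rewrite add1n ltnS; apply: IH.
Qed.

(** Taking the threshold [c] to be the entry of [s] at [i + r], at least [i + r + 1] entries of [s],
    so at least [i + 1] entries of [t], reach it. *)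
Lemma sorted_nth_le_count s t r i :
  sorted >=%R s -> sorted >=%R t -> size s = size t ->
  (forall c, count (>= c) s <= count (>= c) t + r)%N ->
  (i + r < size s)%N -> s`_(i + r) <= t`_i.
Proof.
move=> ss st sst lec lti; have up (c : R) : {homo (>= c) : x y / x <= y >-> x ==> y}.
  by move=> x y xy; apply/implyP => /= /le_trans; apply.
apply: (sorted_nth_count st (up s`_(i + r))).
rewrite -(ltn_add2r r); apply: leq_trans (lec _).
exact: sorted_count_nth.
Qed.

End NonincreasingSeq.

(** * Eigenvalues of real symmetric matrices: diagonalization, Weyl inequalities, Rayleigh
    quotients *)

Section Eigenvalues.
Local Open Scope sesquilinear_scope.
Context {R : rcfType} {n : nat}.
Implicit Types (A B : 'M[R]_n) (d : 'rV[R]_n).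
Local Notation cplx := (map_mx (@real_complex R)).

(** The complex spectral theorem is applied to the complexification of [A]. The spectrum is real, so
    the diagonal can be given by a real vector [d]. *)
Lemma sym_unitary_diag A : A^T = A ->
  exists P d, P \is unitarymx /\ cplx A = P^t* *m diag_mx (cplx d) *m P.
Proof.
move=> symA; have Bsym : cplx A \is symmetricmx.
  by apply/is_hermitianmxP; rewrite expr0 scale1r map_mx_id // map_trmx symA.
have Breal : cplx A \is a realmx.
  by apply/mxOverP=> i j; rewrite mxE; apply/complex_realP; exists (A i j).
have Bherm := realsym_hermsym Bsym Breal.
have /mxOverP dreal := hermitian_spectral_diag_real Bherm.
exists (spectralmx (cplx A)).
exists (map_mx (@complex.Re R) (spectral_diag (cplx A))).
split; first exact: spectral_unitarymx.
rewrite -invmx_unitary ?spectral_unitarymx //.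
rewrite [LHS](orthomx_spectralP (hermitian_normalmx Bherm)).
suff <- : spectral_diag (cplx A) =
    cplx (map_mx (@complex.Re R) (spectral_diag (cplx A))) by [].
by apply/rowP => i; rewrite !mxE RRe_real // dreal.
Qed.

Lemma unitary_diag_eigenvalues A P d :
  P \is unitarymx -> cplx A = P^t* *m diag_mx (cplx d) *m P ->
  perm_eq (eigenvalues A) [seq d 0 i | i <- enum 'I_n].
Proof.
move=> Pu AE; pose C := R[i].
have cA : char_poly (cplx A) = char_poly (diag_mx (cplx d)).
  have PP : map_mx polyC (P^t*) *m map_mx polyC P = 1%:M :> 'M[{poly C}]_n.
    by rewrite -map_mxM -invmx_unitary // mulVmx ?unitarymx_unit // map_mx1.
  rewrite [in LHS]AE /char_poly /char_poly_mx.
  have -> : 'X%:M - map_mx polyC (P^t* *m diag_mx (cplx d) *m P) =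
     map_mx polyC (P^t*) *m ('X%:M - map_mx polyC (diag_mx (cplx d)))
       *m map_mx polyC P.
    rewrite mulmxBr mulmxBl -!map_mxM; congr (_ - _).
    by rewrite scalar_mxC -mulmxA PP mulmx1.
  by rewrite !det_mulmx mulrAC -det_mulmx PP det1 mul1r.
have cE : char_poly A = \prod_(x <- [seq d 0 i | i <- enum 'I_n]) ('X - x%:P).
  apply: (@map_poly_inj _ _ (@real_complex R)).
  rewrite map_char_poly cA char_poly_trig ?diag_mx_is_trig //.
  rewrite rmorph_prod big_map big_enum /=; apply: eq_bigr => i _.
  by rewrite !mxE eqxx rmorphB /= map_polyX map_polyC.
apply/allP=> x _; apply/eqP.
by rewrite [LHS]count_eigenvalues cE mu_prod_XsubC.
Qed.

Lemma sum_eigenvalues A : A^T = A -> \sum_(x <- eigenvalues A) x = \tr A.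
Proof.
case/sym_unitary_diag=> P [d [Pu AE]].
rewrite (perm_big _ (unitary_diag_eigenvalues Pu AE)) big_map big_enum /=.
apply: (@complexI R); rewrite rmorph_sum /=.
have -> : (\tr A)%:C%C = \tr (cplx A).
  by rewrite /mxtrace rmorph_sum; apply: eq_bigr => i _; rewrite mxE.
rewrite AE mxtrace_mulC mulmxA (unitarymxP Pu) mul1mx mxtrace_diag.
by apply: eq_bigr => i _; rewrite mxE.
Qed.

(** Both sides are nonincreasing, and [-d] diagonalizes [- A] in the same basis, so they are
    permutations of each other. *)
Lemma eigenvaluesN A :
  A^T = A -> eigenvalues (- A) = rev (map -%R (eigenvalues A)).
Proof.
move=> symA; have [P [d [Pu AE]]] := sym_unitary_diag symA.
apply: (@sorted_eq _ >=%R).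
- by move=> y x z /= /[swap]; apply: le_trans.
- by move=> x y /= /andP[yx xy]; apply/le_anti/andP.
- exact: sorted_eigenvalues.
- rewrite rev_sorted sorted_map.
  apply: sub_sorted (sorted_eigenvalues A) => x y /=.
  by rewrite lerN2.
rewrite perm_sym perm_rev.
have /(perm_trans _) -> //: perm_eq [seq (- d) 0 i | i <- enum 'I_n] (eigenvalues (- A)).
  rewrite perm_sym; apply: (unitary_diag_eigenvalues Pu).
  have -> : diag_mx (cplx (- d)) = - diag_mx (cplx d) by rewrite map_mxN raddfN.
  by rewrite map_mxN AE mulmxN mulNmx.
rewrite (eq_map (g := -%R \o d 0)); last by move=> i; rewrite /= mxE.
by rewrite map_comp perm_map // (unitary_diag_eigenvalues Pu AE).
Qed.

(** The columns of [w] impose [r] linear conditions, which cost a shift of [r] indices. The case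
    [r = 0] is Weyl monotonicity, and [r = 1] gives interlacing under a rank one perturbation. *)
Lemma eigenvalues_weyl A B r (w : 'M[R]_(n, r)) i :
  A^T = A -> B^T = B ->
  (forall x, x *m cplx w = 0 -> hform (cplx A) x <= hform (cplx B) x) ->
  (i + r < n)%N -> (eigenvalues A)`_(i + r) <= (eigenvalues B)`_i.
Proof.
move=> symA symB leAB lti.
have [P [a [Pu AE]]] := sym_unitary_diag symA.
have [Q [b [Qu BE]]] := sym_unitary_diag symB.
apply: sorted_nth_le_count; rewrite ?size_eigenvalues ?sorted_eigenvalues //.
move=> c; rewrite (permP (unitary_diag_eigenvalues Pu AE)).
rewrite (permP (unitary_diag_eigenvalues Qu BE)) (count_map (a 0)) (count_map (b 0)).
have := @card_eigen_ge_le _ n r P Q (cplx a) (cplx b) (cplx w) c%:C%C Pu Qu.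
rewrite -AE -BE => /(_ _ _ leAB) le.
have E (d : 'rV[R]_n) :
    #|[set i | (c%:C%C <= (cplx d) 0 i)%R]| =
      count [pred i | c <= d 0 i] (enum 'I_n).
  rewrite -sum1_count big_enum_cond -sum1_card; apply: eq_bigl => j.
  by rewrite !inE mxE lecR.
rewrite !E in le; apply: le; first by apply/complex_realP; exists c.
by move=> j; rewrite mxE; apply/complex_realP; exists (b 0 j).
Qed.

Lemma hform_le_eigenvalue0 A x :
  A^T = A -> hform (cplx A) x <= ((eigenvalues A)`_0)%:C%C * hform 1%:M x.
Proof.
move=> symA; have [P [d [Pu AE]]] := sym_unitary_diag symA.
rewrite AE hform_conj -(hform1_unitary _ Pu) hform_diag hform1 mulr_sumr.
apply: ler_sum => i _; rewrite mxE ler_wpM2r ?exprn_ge0 // lecR.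
have : d 0 i \in eigenvalues A.
  by rewrite (perm_mem (unitary_diag_eigenvalues Pu AE)) map_f // mem_enum.
have := sorted_eigenvalues A; rewrite sorted_pairwise; last first.
  by move=> y z t /= /[swap]; apply: le_trans.
case: eigenvalues => //= t s /andP[/allP ts _]; rewrite inE => /predU1P[->//|].
exact: ts.
Qed.

Lemma hform_eigenvalue A y :
  A^T = A -> y \in eigenvalues A ->
  exists2 x, x != 0 & hform (cplx A) x = y%:C%C * hform 1%:M x.
Proof.
move=> symA; have [P [d [Pu AE]]] := sym_unitary_diag symA.
rewrite (perm_mem (unitary_diag_eigenvalues Pu AE)) => /mapP[i _ ->].
exists (delta_mx 0 i *m P).
  apply/eqP => /(congr1 (mulmx^~ (P^t*))); rewrite -mulmxA (unitarymxP Pu) mulmx1.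
  rewrite mul0mx => /rowP/(_ i)/eqP; rewrite !mxE !eqxx oner_eq0 //.
rewrite AE hform_conj -(hform1_unitary _ Pu) -mulmxA (unitarymxP Pu) mulmx1.
rewrite hform_diag hform1 mulr_sumr; apply: eq_bigr => j _; rewrite !mxE eqxx /=.
by case: (eqVneq j i) => [->//|_]; rewrite normr0 expr0n !mulr0.
Qed.

End Eigenvalues.

(** * Convexity of the truncated power and the cost of an interlaced descent *)

Section ConvexIncrements.
Context {R : realType}.

Lemma ler_pos_powR (p : R) : 0 <= p ->
  {homo (fun x => Num.max x 0 `^ p) : x y / x <= y}.
Proof.
move=> p0 x y xy; have max0 z : 0 <= Num.max z 0 :> R by rewrite le_max lexx orbT.
apply: ge0_ler_powR => //; rewrite ?nnegrE ?max0 //.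
by rewrite ge_max !le_max xy lexx orbT.
Qed.

(** The points [b - d] and [a] lie between [a - d] and [b] and have the same sum, so convexity
    applies. *)
Lemma pos_powR_increment (p a b d : R) : 1 <= p -> a <= b -> 0 <= d ->
  Num.max (b - d) 0 `^ p + Num.max a 0 `^ p <=
  Num.max b 0 `^ p + Num.max (a - d) 0 `^ p.
Proof.
move=> p1 ab d0; have p0 : 0 <= p by apply: le_trans p1.
pose f (x : R) := Num.max x 0 `^ p; rewrite -!/(f _).
(* The library convexity of the power holds on nonnegative reals. It passes to the truncation since
   [x] and [y] are at most [x'] and [y'] and [f] is nondecreasing. *)
have conv (t x y : R) : 0 <= t -> t <= 1 ->
    f (t * x + (1 - t) * y) <= t * f x + (1 - t) * f y.
  move=> t0 t1; pose x' := Num.max x 0; pose y' := Num.max y 0.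
  have x0 : 0 <= x' by rewrite le_max lexx orbT.
  have y0 : 0 <= y' by rewrite le_max lexx orbT.
  have xx : x <= x' by rewrite le_max lexx.
  have yy : y <= y' by rewrite le_max lexx.
  have t'0 : 0 <= 1 - t by rewrite subr_ge0.
  have xy0 : 0 <= t * x' + (1 - t) * y' by rewrite addr_ge0 ?mulr_ge0.
  apply: (@le_trans _ _ ((t * x' + (1 - t) * y') `^ p)).
    rewrite -[X in _ <= X `^ _](max_idPl xy0); apply: ler_pos_powR => //.
    by rewrite lerD // ler_wpM2l.
  have := @convex_powR _ _ p1 (Itv01 t0 t1) x' y'.
  rewrite !classical_sets.in_setE /= !in_itv /= !andbT !convRE /=; exact.
have [bE|bNE] := eqVneq (b - (a - d)) 0.
  have -> : d = 0 by lra.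
  have -> : a = b by lra.
  by rewrite addrC.
(* The weight [t] writes [b - d] as a mean of [a - d] and [b], and the swapped weights give [a].
   Adding the two convexity inequalities cancels [t]. *)
pose D := b - (a - d); pose t := d / D.
have D0 : 0 < D by rewrite lt_neqAle eq_sym bNE /D; lra.
have t0 : 0 <= t by rewrite divr_ge0 // ltW.
have t1 : t <= 1 by rewrite ler_pdivrMr // mul1r /D; lra.
have -> : b - d = t * (a - d) + (1 - t) * b by rewrite /t /D; field.
have aE : a = t * b + (1 - t) * (a - d) by rewrite /t /D; field.
rewrite [X in _ + f X <= _]aE.
have := conv t b (a - d) t0 t1; have := conv t (a - d) b t0 t1; lra.
Qed.

(** Induction on [m]: the descent [S] of the tail is first concentrated at index 1, then moved up to
    [b 0] by the increment inequality, as [a 1 <= b 0]. There it joins the descent from [a 0] to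
    [b 0]. *)
Lemma interlaced_sum (f : R -> R) m (a b : nat -> R) :
  (forall x y d, x <= y -> 0 <= d -> f (y - d) + f x <= f y + f (x - d)) ->
  (forall i, (i <= m)%N -> b i <= a i) ->
  (forall i, (i < m)%N -> a i.+1 <= b i) ->
  f (a 0%N - \sum_(0 <= i < m.+1) (a i - b i)) + \sum_(0 <= i < m) f (a i.+1)
    <= \sum_(0 <= i < m.+1) f (b i).
Proof.
move=> incr; elim: m a b => [|m IH] a b leba leab.
  by rewrite !big_nat1 big_geq // addr0 subKr.
rewrite big_nat_recl // [\sum_(0 <= i < m.+1) f (a _)]big_nat_recl //.
rewrite [X in _ <= X]big_nat_recl //.
set S := \sum_(0 <= i < m.+1) (_ - _).
have S0 : 0 <= S.
  by rewrite /S big_nat; apply: sumr_ge0 => i /andP[_ ?]; rewrite subr_ge0 leba.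
have := IH (a \o succn) (b \o succn) (fun i => leba i.+1) (fun i => leab i.+1).
have := incr _ _ _ (leab 0%N isT) S0.
rewrite /= -/S; have -> : a 0%N - (a 0%N - b 0%N + S) = b 0%N - S by ring.
lra.
Qed.

End ConvexIncrements.

(** * Rank one perturbations and monotonicity of the largest eigenvalue *)

Section RankOne.
Local Open Scope sesquilinear_scope.
Context {R : realType} {n : nat}.
Implicit Types (A B : 'M[R]_n) (v w : 'cV[R]_n).
Local Notation cplx := (map_mx (@real_complex R)).

Lemma hform_rank1 c w x :
  hform (cplx (c *: (w *m w^T))) x = c%:C%C * `|(x *m cplx w) 0 0| ^+ 2.
Proof.
have wx : (x *m cplx w)^t* = cplx w^T *m x^t*.
  rewrite trmx_mul map_mxM; congr (_ *m _).
  by apply/matrixP=> i j; rewrite !mxE; apply: conj_Creal;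
    apply/complex_realP; exists (w j i).
rewrite /hform map_mxZ map_mxM -scalemxAr -scalemxAl mxE mulmxA -[_ *m x^t*]mulmxA.
by rewrite -wx mxE big_ord1 !mxE normCK.
Qed.

Lemma psd_rank1 c w x : 0 <= c -> 0 <= hform (cplx (c *: (w *m w^T))) x.
Proof. by move=> c0; rewrite hform_rank1 mulr_ge0 ?exprn_ge0 // lecR. Qed.

Lemma rank1_sym c w : (c *: (w *m w^T))^T = c *: (w *m w^T).
Proof. by rewrite linearZ /= trmx_mul trmxK. Qed.

(** Passing from [A] to [M] is an interlaced descent, which [interlaced_sum] bounds from index [k]
    on; passing from [M] to [B] only raises eigenvalues. *)
Lemma rank_one_descent A B v w (c : R) (f : R -> R) k :
  A^T = A -> B = A - c *: (w *m w^T) + c *: (v *m v^T) -> 0 <= c ->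
  {homo f : x y / x <= y} ->
  (forall x y d, x <= y -> 0 <= d -> f (y - d) + f x <= f y + f (x - d)) ->
  (k < n)%N ->
  f ((eigenvalues A)`_k - c * \tr (w *m w^T))
      + \sum_(k.+1 <= i < n) f (eigenvalues A)`_i
    <= \sum_(k <= i < n) f (eigenvalues B)`_i.
Proof.
move=> symA BE c0 fhomo incr kn; pose M := A - c *: (w *m w^T).
have symM : M^T = M by rewrite /M linearB /= rank1_sym symA.
have symB : B^T = B by rewrite BE -/M linearD /= rank1_sym symM.
have AE : A = M + c *: (w *m w^T) by rewrite /M subrK.
rewrite -/M in BE; clearbody M.
have leMA i : (i < n)%N -> (eigenvalues M)`_i <= (eigenvalues A)`_i.
  rewrite -[i in (i < n)%N]addn0 -[i in (eigenvalues M)`_i]addn0.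
  apply: (@eigenvalues_weyl _ _ _ _ _ 0) => // x _.
  by rewrite [in X in _ <= X]AE map_mxD hformD lerDl psd_rank1.
have leMB i : (i < n)%N -> (eigenvalues M)`_i <= (eigenvalues B)`_i.
  rewrite -[i in (i < n)%N]addn0 -[i in (eigenvalues M)`_i]addn0.
  apply: (@eigenvalues_weyl _ _ _ _ _ 0) => // x _.
  by rewrite BE map_mxD hformD lerDl psd_rank1.
(* On vectors killed by [w] the forms of [A] and [M] agree, so one condition suffices. *)
have leAM i : (i.+1 < n)%N -> (eigenvalues A)`_i.+1 <= (eigenvalues M)`_i.
  rewrite -[i.+1]addn1; apply: (eigenvalues_weyl (w := w)) => // x xw.
  by rewrite [in X in X <= _]AE map_mxD hformD hform_rank1 xw mxE
    normr0 expr0n mulr0 addr0.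
(* The trace gives the descent over all indices. Those before [k] contribute nonnegative terms, so
   dropping them leaves an upper bound. *)
have tail_le : \sum_(k <= i < n) ((eigenvalues A)`_i - (eigenvalues M)`_i)
    <= c * \tr (w *m w^T).
  have -> : c * \tr (w *m w^T) =
      \sum_(0 <= i < n) ((eigenvalues A)`_i - (eigenvalues M)`_i).
    have sumE (N : 'M[R]_n) : N^T = N -> \sum_(0 <= i < n) (eigenvalues N)`_i = \tr N.
      by move=> symN; rewrite -sum_eigenvalues // [RHS](big_nth 0) size_eigenvalues //.
    by rewrite sumrB !sumE // -raddfB /= AE addrC addKr mxtraceZ.
  rewrite (@big_cat_nat _ _ _ k 0 n) ?(ltnW kn) //= lerDr big_nat.
  by apply: sumr_ge0 => i /andP[_ ik]; rewrite subr_ge0 leMA // (ltn_trans ik).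
have [m nE] : exists m, (n - k = m.+1)%N by exists (n - k).-1; rewrite prednK // subn_gt0.
have lek i : (i <= m)%N -> (i + k < n)%N.
  by rewrite -ltnS -nE ltn_subRL addnC.
apply: le_trans (_ : \sum_(k <= i < n) f (eigenvalues M)`_i <= _); last first.
  by rewrite big_nat [X in _ <= X]big_nat;
    apply: ler_sum => i /andP[_ lti]; apply/fhomo/leMB.
have := interlaced_sum (m := m) (a := fun i => (eigenvalues A)`_(i + k))
  (b := fun i => (eigenvalues M)`_(i + k)) incr.
rewrite -nE add0n -(big_addn 0 n k xpredT (fun i => _ i - _ i)).
rewrite -(big_addn 0 n k xpredT (fun i => f (eigenvalues M)`_i)) add0n => descent.
apply: le_trans (descent _ _) => [|i im|i im]; last 2 first.
- exact/leMA/lek.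
- exact/leAM/(lek i.+1).
(* By [tail_le], subtracting the full trace instead of the tail descent only lowers the argument of
   [f]. *)
rewrite lerD ?fhomo ?lerB //.
rewrite -[k.+1]add0n big_addn subnS nE /=.
by under eq_bigr do rewrite addnS -addSn.
Qed.

Lemma rank_one_sum A B v w (c : R) (f : R -> R) :
  A^T = A -> B = A - c *: (w *m w^T) + c *: (v *m v^T) -> 0 <= c ->
  {homo f : x y / x <= y} ->
  (forall x y d, x <= y -> 0 <= d -> f (y - d) + f x <= f y + f (x - d)) ->
  (0 < n)%N ->
  \sum_(0 <= i < n) f (eigenvalues A)`_i
      + f ((eigenvalues A)`_0 - c * \tr (w *m w^T)) - f (eigenvalues A)`_0
    <= \sum_(0 <= i < n) f (eigenvalues B)`_i.
Proof.
move=> symA BE c0 fhomo incr n0.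
have := rank_one_descent symA BE c0 fhomo incr n0.
by rewrite [X in _ -> X + _ - _ <= _](big_ltn n0); lra.
Qed.

Lemma rank_one_sum_behead A B v w (c : R) (f : R -> R) :
  A^T = A -> B = A - c *: (w *m w^T) + c *: (v *m v^T) -> 0 <= c ->
  {homo f : x y / x <= y} ->
  (forall x y d, x <= y -> 0 <= d -> f (y - d) + f x <= f y + f (x - d)) ->
  (1 < n)%N -> (eigenvalues A)`_0 <= (eigenvalues B)`_0 ->
  \sum_(0 <= i < n) f (eigenvalues A)`_i
      + f ((eigenvalues A)`_1 - c * \tr (w *m w^T)) - f (eigenvalues A)`_1
    <= \sum_(0 <= i < n) f (eigenvalues B)`_i.
Proof.
move=> symA BE c0 fhomo incr n1 /fhomo le0.
have := rank_one_descent symA BE c0 fhomo incr n1.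
have n0 : (0 < n)%N by apply: ltnW.
rewrite [X in _ -> X + _ - _ <= _](big_ltn n0) [X in _ -> _ <= X](big_ltn n0).
by rewrite [X in _ -> _ + X + _ - _ <= _](big_ltn n1); lra.
Qed.

(** Perron-Frobenius argument: replace a top eigenvector [x] of [A] by the vector [y] of its moduli.
    The norm is kept, and the form of [B] at [y] is at least that of [A] at [x] by the triangle
    inequality. *)
Lemma eigenvalue0_homo A B :
  A^T = A -> B^T = B -> (0 < n)%N ->
  (forall i j, 0 <= A i j) -> (forall i j, A i j <= B i j) ->
  (eigenvalues A)`_0 <= (eigenvalues B)`_0.
Proof.
move=> symA symB n0 A0 leAB.
have hformE (N : 'M[R]_n) x :
    hform (cplx N) x = \sum_j \sum_i x 0 i * (N i j)%:C%C * (x 0 j)^*.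
  rewrite /hform mxE; apply: eq_bigr => j _; rewrite !mxE mulr_suml.
  by apply: eq_bigr => i _; rewrite !mxE.
have [|x x0 xE] := hform_eigenvalue symA (y := (eigenvalues A)`_0).
  by rewrite mem_nth // size_eigenvalues.
pose y : 'rV[R[i]]_n := \row_i `|x 0 i|.
have yx : hform 1%:M y = hform 1%:M x.
  by rewrite !hform1; apply: eq_bigr => i _; rewrite mxE normr_id.
have x_gt0 : 0 < hform 1%:M x.
  rewrite hform1 lt_neqAle sumr_ge0 ?andbT => [|i _]; last exact: exprn_ge0.
  apply: contra_neq x0 => /esym/eqP; rewrite psumr_eq0 => [/allP x0|i _];
    last exact: exprn_ge0.
  apply/rowP => i; rewrite mxE; apply/eqP; rewrite -normr_eq0 -sqrf_eq0.
  by apply: x0; rewrite mem_index_enum.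
rewrite -lecR -(ler_pM2r x_gt0) -xE -[in X in _ <= X]yx.
apply: le_trans (hform_le_eigenvalue0 y symB).
(* The form of [A] at [x] is a real eigenvalue times a squared norm, so it is real and bounded by
   its modulus. *)
apply: le_trans (real_ler_norm _) _.
  rewrite xE; apply: rpredM; last exact: gtr0_real.
  by apply/complex_realP; exists (eigenvalues A)`_0.
rewrite !hformE; apply: le_trans (ler_norm_sum _ _ _) _; apply: ler_sum => j _.
apply: le_trans (ler_norm_sum _ _ _) _; apply: ler_sum => i _.
rewrite !normrM norm_conjC !mxE conj_normC -mulrA -mulrA ler_wpM2l // ler_wpM2r //.
by rewrite ger0_norm ?lecR.
Qed.

End RankOne.

(** * Energies as sums over all eigenvalues, and edge deletion as a rank two change *)

Section Graphs.
Context {R : realType}.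

(** A nonpositive eigenvalue contributes a power of 0, which vanishes because [p != 0]. *)
Lemma pos_energyE (p : R) (V : finType) (G : sgraph V) : p != 0 ->
  pos_energy p G =
    \sum_(0 <= i < #|V|) Num.max (eigenvalues (adjmx R G))`_i 0 `^ p.
Proof.
move=> p0; rewrite -[X in index_iota _ X](size_eigenvalues (adjmx_sym R G)).
rewrite -(big_nth 0 xpredT (fun x : R => Num.max x 0 `^ p)) /pos_energy.
rewrite big_mkcond; apply: eq_bigr => x _.
by case: ltP => [//|_]; rewrite powR0.
Qed.

Lemma neg_energyE (p : R) (V : finType) (G : sgraph V) : p != 0 ->
  neg_energy p G =
    \sum_(0 <= i < #|V|) Num.max (eigenvalues (- adjmx R G))`_i 0 `^ p.
Proof.
move=> p0; have symN : (- adjmx R G)^T = - adjmx R G.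
  by rewrite linearN /= adjmx_sym.
rewrite -[X in index_iota _ X](size_eigenvalues symN).
rewrite -(big_nth 0 xpredT (fun x : R => Num.max x 0 `^ p)) /neg_energy.
rewrite eigenvaluesN ?adjmx_sym // [RHS]big_rev [RHS]big_map [LHS]big_mkcond.
apply: eq_bigr => x _; rewrite maxEle oppr_le0.
by case: ltP => [/ltr0_norm ->|_] //; rewrite powR0.
Qed.

Lemma trace_rank1 n (u : 'cV[R]_n) : \tr (u *m u^T) = \sum_i u i 0 ^+ 2.
Proof. by apply: eq_bigr => i _; rewrite !mxE big_ord1 mxE. Qed.

Lemma eq_set2 (T : finType) (a b x y : T) :
  ([set a; b] == [set x; y]) =
    (a == x) && (b == y) || (a == y) && (b == x).
Proof.
apply/eqP/idP => [/setP abE|/orP[]/andP[/eqP-> /eqP->] //]; last by rewrite setUC.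
have := abE a; have := abE b; have := abE x; have := abE y.
rewrite !inE !eqxx !orbT /= ![x == _]eq_sym ![y == _]eq_sym.
by case: (a == x); case: (a == y); case: (b == x); case: (b == y).
Qed.

Lemma adjmx_del_edge (V : finType) (G : sgraph V) (e : {set V}) :
  e \in edges G -> exists v w : 'cV[R]_#|V|,
  [/\ adjmx R G = adjmx R (del_edge G e) - 2^-1 *: (w *m w^T) + 2^-1 *: (v *m v^T),
      2^-1 * \tr (w *m w^T) = 1 & 2^-1 * \tr (v *m v^T) = 1].
Proof.
case/imsetP=> -[x y]; rewrite inE /= => xy eE.
have xNy : x != y by apply: contraTneq xy => ->; rewrite adj_irr.
pose i := enum_rank x; pose j := enum_rank y.
have iNj : i != j by rewrite (inj_eq enum_rank_inj).
(* The sign turns both vectors into one family: [u false] is the sum and [u true] the difference of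
   the basis vectors at the ends of [e]. *)
pose u b : 'cV[R]_#|V| := \col_k ((k == i)%:R + (-1) ^+ b * (k == j)%:R).
have tr_u b : 2^-1 * \tr (u b *m (u b)^T) = 1.
  rewrite trace_rank1 (bigD1 i) // (bigD1 j) 1?eq_sym //= big1 => [|k].
    rewrite !mxE !eqxx (negPf iNj) eq_sym (negPf iNj) mulr0 mulr1 addr0 add0r addr0.
    by rewrite sqrr_sign expr1n; field.
  by case/andP=> /negPf ki /negPf kj; rewrite !mxE ki kj mulr0 addr0 expr0n.
exists (u false), (u true); split=> //; apply/matrixP=> k l.
rewrite !mxE !big_ord1 !mxE /= expr0 expr1 /del_adj.
have eqE z t : (z == enum_rank t) = (enum_val z == t).
  by rewrite -(inj_eq enum_val_inj) enum_rankK.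
rewrite !eqE eE; set a := enum_val k; set b := enum_val l.
rewrite eq_set2.
(* These four facts rule out the impossible truth values. In the remaining cases the half products
   cancel on the diagonal and add up to 1 exactly at the two entries of the edge. *)
have axy : ~~ ((a == x) && (a == y)).
  by apply: contra xNy => /andP[/eqP <- /eqP <-].
have bxy : ~~ ((b == x) && (b == y)).
  by apply: contra xNy => /andP[/eqP <- /eqP <-].
have abxy : (a == x) && (b == y) ==> adj G a b.
  by apply/implyP => /andP[/eqP-> /eqP->].
have abyx : (a == y) && (b == x) ==> adj G a b.
  by apply/implyP => /andP[/eqP-> /eqP->]; rewrite adj_sym.
move: (adj G a b) (a == x) (a == y) (b == x) (b == y) axy bxy abxy abyx.
by do 5![case] => //= _ _ _ _; field.
Qed.

End Graphs.

Theorem theorem2p1 (R : realType) (p : R) (V : finType) (G : sgraph V)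
    (e : {set V}) (n := #|V|) (H := del_edge G e) (theta := eigval R H) :
  1 <= p ->
  e \in edges G ->
  (2 <= count (fun x => (0 < x :> R)%R) (eigenvalues (adjmx R H)))%N ->
  (2 <= count (fun x => (x < 0 :> R)%R) (eigenvalues (adjmx R H)))%N ->
  pos_energy p G >=
    pos_energy p H + Num.max (theta 2%N - 1) 0 `^ p - theta 2%N `^ p
  /\
  neg_energy p G >=
    neg_energy p H + Num.max (- theta n - 1) 0 `^ p - `|theta n| `^ p.
Proof.
move=> p1 eG pos2 neg2; have p0 : 0 <= p by apply: le_trans p1.
have pN0 : p != 0 by rewrite gt_eqF // (lt_le_trans _ p1).
have [v [w [GE trw trv]]] := @adjmx_del_edge R _ _ _ eG.
rewrite -/H in GE; set A := adjmx R H in GE pos2 neg2.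
have symA : A^T = A by exact: adjmx_sym.
have n2 : (1 < n)%N.
  have sizeA : size (eigenvalues A) = n by exact: size_eigenvalues.
  by rewrite -sizeA; apply: leq_trans pos2 (count_size _ _).
have n0 : (0 < n)%N by apply: ltnW.
have c0 : 0 <= 2^-1 :> R by rewrite invr_ge0 ler0n.
have incr := fun x y d => @pos_powR_increment R p x y d p1.
split.
  have theta2 : 0 < theta 2%N.
    apply: (sorted_nth_count (P := fun x => 0 < x) (sorted_eigenvalues A)) pos2.
    by move=> x y xy; apply/implyP => /lt_le_trans; apply.
  (* Adjacency entries are nonnegative and deletion only decreases them. This lets the descent start
     at index 1, which holds the second eigenvalue. *)
  have le_head : (eigenvalues A)`_0 <= (eigenvalues (adjmx R G))`_0.
    apply: eigenvalue0_homo; rewrite ?adjmx_sym // => i j; rewrite !mxE ?ler0n //.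
    by rewrite ler_nat /= /del_adj; case: adj => //; case: (_ != _).
  have := rank_one_sum_behead symA GE c0 (ler_pos_powR p0) incr n2 le_head.
  rewrite trw [X in _ + _ - X `^ p](max_idPl (ltW theta2)).
  by rewrite (pos_energyE G pN0) (pos_energyE H pN0).
have symN : (- A)^T = - A by rewrite linearN /= symA.
(* Negation exchanges [v] and [w]: the descent now comes from [v], again with total 1. *)
have GNE : - adjmx R G = - A - 2^-1 *: (v *m v^T) + 2^-1 *: (w *m w^T).
  by rewrite GE !opprD opprK addrAC.
(* The largest eigenvalue of [- A] is minus the smallest of [A], so here the descent is placed at
   index 0. *)
have thetan : (eigenvalues (- A))`_0 = - theta n.
  rewrite eigenvaluesN // nth_rev ?size_map ?size_eigenvalues // subn1.
  by rewrite (nth_map 0) // size_eigenvalues // prednK.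
have thetan0 : 0 < - theta n.
  rewrite -thetan; apply: (sorted_nth_count (P := fun x => 0 < x) (sorted_eigenvalues _)).
    by move=> x y xy; apply/implyP => /lt_le_trans; apply.
  rewrite eigenvaluesN // count_rev count_map; apply: leq_trans (ltnW neg2) _.
  by rewrite leq_eqVlt; apply/orP; left; apply/eqP/eq_count => x; rewrite /= oppr_gt0.
have := rank_one_sum symN GNE c0 (ler_pos_powR p0) incr n0.
rewrite trv thetan (neg_energyE G pN0) (neg_energyE H pN0).
by rewrite (max_idPl (ltW thetan0)) -[`|theta n|]normrN gtr0_norm.
Qed.
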